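(* Let $\Delta$ be a reflexive polytope in $M_{\mathbb R}$ and let $\Delta=\Delta_0+\cdots+\Delta_k$ be a Minkowski sum decomposition by lattice polytopes in $M_{\mathbb R}$. Then $\hat\nabla_0+\dots+\hat\nabla_k$ is a reflexive polytope in $\tilde N_{\mathbb R}=N_{\mathbb R}\oplus\mathbb R^k$. Moreover, $\hat\nabla_0+\dots+\hat\nabla_k$ is a nef-partition dual to $\tilde\Delta_0+\cdots+\tilde\Delta_k$, and the following identities hold: $$(\hat\nabla_0\uplus\dots\uplus\hat\nabla_k)^*=\tilde\Delta_0+\cdots+\tilde\Delta_k,\qquad (\tilde\Delta_0\uplus\cdots\uplus\tilde\Delta_k)^*=\hat\nabla_0+\dots+\hat\nabla_k.$$
   Context: $M$ and $N$ are dual lattices of finite rank with pairing $\langle\cdot,\cdot\rangle:M\times N\to\mathbb Z$; $M_{\mathbb R}=M\otimes\mathbb R$, $N_{\mathbb R}=N\otimes\mathbb R$. A lattice polytope is a polytope whose vertices are lattice points. A lattice polytope $\Delta\subset M_{\mathbb R}$ is reflexive if it contains $0$ in its interior and the dual polytope $\Delta^*=\{n\in N_{\mathbb R}\mid\langle m,n\rangle\ge-1\ \forall m\in\Delta\}$ is also a lattice polytope; the same definitions are used for any pair of dual lattices (with the roles of the two lattices possibly exchanged). Put $\tilde M=M\oplus\mathbb Z^k$ with $\{e_1,\dots,e_k\}$ the standard basis of the summand $\mathbb Z^k$, $\tilde N=N\oplus\mathbb Z^k$ the dual lattice with $\{e_1^*,\dots,e_k^*\}$ the dual basis, and $e_0=-\sum_{i=1}^k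 e_i$. For a polytope $P\subset M_{\mathbb R}$ and $u\in N_{\mathbb R}$, $\min\langle P,u\rangle=\min_{x\in P}\langle x,u\rangle$. Define $$\hat\nabla_0=\mathrm{Conv}\Bigl(\bigl\{u-\sum_{i=1}^k\min\langle\Delta_i,u\rangle e_i^*\mid u\in\Delta^*\bigr\}\cup\{e_1^*,\dots,e_k^*\}\Bigr),\quad \hat\nabla_i=\hat\nabla_0-e_i^*\ (1\le i\le k),$$ $$\tilde\Delta_i=\mathrm{Conv}\bigl((\Delta_i+e_i)\cup\{0\}\bigr)\ (0\le i\le k).$$ For subsets $P,Q$ of a real vector space, $P\uplus Q=\mathrm{Conv}(P\cup Q)$. A nef-partition of a reflexive polytope $P$ is a Minkowski sum decomposition $P=P_0+\dots+P_k$ by lattice polytopes with $0\in P_i$ for all $i$. Its dual nef-partition is $Q=Q_0+\dots+Q_k$ in the dual space, where $Q_j=\{y\mid\langle x,y\rangle\ge-\delta_{ij}\ \forall x\in P_i,\ i=0,\dots,k\}$ ($\delta_{ij}$ the Kronecker symbol); it is known that $Q$ is reflexive and that $Q_0+\dots+Q_k$ is a nef-partition. *)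

(* Defs.v *)
From HB Require Import structures.
From mathcomp Require Import all_boot all_order all_algebra.
From mathcomp Require Import all_classical all_reals all_analysis.
Import Order.TTheory GRing.Theory Num.Theory.
Import numFieldNormedType.Exports.

Set Implicit Arguments.
Unset Strict Implicit.
Unset Printing Implicit Defensive.

Local Open Scope classical_set_scope.
Local Open Scope ring_scope.

(* R is the field of real numbers.  A pair of dual lattices of rank n is
   written in dual bases: both real spaces
   are 'rV[R]_n, both lattices are the integer row vectors, and the pairing is
   the standard one.  The dual of the lattice M (+) Z^k is then N (+) Z^k, with
   vectors row_mx x a in 'rV[R]_(n + k). *)

Section Polytopes.
Variable R : realType.

Definition conv (V : lmodType R) (A : set V) : set V :=
  smallest (@convex_set R V) A.

Definition polytope (V : lmodType R) (P : set V) : Prop :=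
  exists s : seq V, P = conv [set` s].

(* The vertices of a polytope are its extreme points. *)
Definition vertex (V : lmodType R) (P : set V) (v : V) : Prop :=
  P v /\ forall (x y : V) (t : R), P x -> P y -> 0 < t < 1 ->
    v = t *: x + (1 - t) *: y -> x = v /\ y = v.

Definition minkowski_sum (V : lmodType R) (m : nat) (P : 'I_m -> set V) : set V :=
  [set x | exists2 f : 'I_m -> V, (forall i, P i (f i)) & x = \sum_i f i].

Definition uplus (V : lmodType R) (m : nat) (P : 'I_m -> set V) : set V :=
  conv (\bigcup_i P i).

Definition lattice_point (n : nat) (x : 'rV[R]_n) : Prop :=
  x \is a mxOver Num.int.

Definition lattice_polytope (n : nat) (P : set 'rV[R]_n) : Prop :=
  polytope P /\ forall v, vertex P v -> lattice_point v.

Definition pairing (n : nat) (x y : 'rV[R]_n) : R := (x *m y^T) 0 0.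

Definition polar (n : nat) (P : set 'rV[R]_n) : set 'rV[R]_n :=
  [set y | forall x, P x -> -1 <= pairing x y].

Definition reflexive_polytope (n : nat) (P : set 'rV[R]_n) : Prop :=
  [/\ lattice_polytope P, interior P 0 & lattice_polytope (polar P)].

Definition is_min (A : set R) (c : R) : Prop := A c /\ lbound A c.

(* The minimum of <x, u> over x in P; it is 0 when there is no minimum, which
   does not happen for a nonempty polytope. *)
Definition min_pairing (n : nat) (P : set 'rV[R]_n) (u : 'rV[R]_n) : R :=
  xget 0 (is_min [set pairing x u | x in P]).

Definition nef_partition (n k : nat) (P : set 'rV[R]_n)
    (Ps : 'I_k.+1 -> set 'rV[R]_n) : Prop :=
  [/\ reflexive_polytope P,
      (forall i, lattice_polytope (Ps i) /\ Ps i 0)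
    & P = minkowski_sum Ps].

Definition nef_dual (n k : nat) (Ps : 'I_k.+1 -> set 'rV[R]_n) (j : 'I_k.+1) :
    set 'rV[R]_n :=
  [set y | forall i x, Ps i x -> - (i == j)%:R <= pairing x y].

End Polytopes.

Section Cayley.
Variables (R : realType) (n k : nat).

(* With i : 'I_k numbered from 0, this is both e_(i+1) and its dual e*_(i+1). *)
Definition basis_vec (i : 'I_k) : 'rV[R]_(n + k) := row_mx 0 (delta_mx 0 i).

(* The vectors e_0 = - (e_1 + ... + e_k), e_1, ..., e_k. *)
Definition e_vec (i : 'I_k.+1) : 'rV[R]_(n + k) :=
  if unlift ord0 i is Some j then basis_vec j else - \sum_(j < k) basis_vec j.

Definition Delta_tilde (Ds : 'I_k.+1 -> set 'rV[R]_n) (i : 'I_k.+1) :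
    set 'rV[R]_(n + k) :=
  conv ([set row_mx x 0 + e_vec i | x in Ds i] `|` [set 0]).

Definition nabla_hat0 (D : set 'rV[R]_n) (Ds : 'I_k.+1 -> set 'rV[R]_n) :
    set 'rV[R]_(n + k) :=
  conv ([set row_mx u 0
             - \sum_(i < k) min_pairing (Ds (lift ord0 i)) u *: basis_vec i
           | u in polar D]
        `|` range basis_vec).

Definition nabla_hat (D : set 'rV[R]_n) (Ds : 'I_k.+1 -> set 'rV[R]_n)
    (i : 'I_k.+1) : set 'rV[R]_(n + k) :=
  if unlift ord0 i is Some j
  then [set y - basis_vec j | y in nabla_hat0 D Ds]
  else nabla_hat0 D Ds.

End Cayley.

(* Main.v *)
(** Let E_0 = 0 and let E_1, ..., E_k be the dual basis vectors e*_1, ..., e*_k.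
    Evaluating [y] on the generators [m + e_i] of tilde Delta_i shows that the
    j-th dual polytope N_j is the translate of N_0 by -E_j, and that whenever
    [<m + e_i, y> >= - c_i] for all [m] in Delta_i, with [C = sum_j c_j > 0], the
    point [z = (y + sum_j c_j E_j) / C] lies in N_0; thus
    [y = sum_j c_j (z - E_j)] with [z - E_j] in N_j.  Taking [c = 1] gives
    (uplus_i tilde Delta_i)^* = sum_j N_j; taking for [y] a hyperplane separating
    a point from sum_i tilde Delta_i, and for [c] a slight increase of the
    negated minima of [y] on the summands, gives
    (uplus_j N_j)^* = sum_i tilde Delta_i.
    That N_0 = hat nabla_0 is a lattice polytope holds because every [u] in
    Delta^* is in the cone over a face of Delta^* on which all the functions
    min<Delta_i, .> are linear, so that the vertices of Delta^* suffice to
    generate hat nabla_0. *)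
Require Import Defs.
From HB Require Import structures.
From mathcomp Require Import all_boot all_order all_algebra.
From mathcomp Require Import all_classical all_reals all_analysis.
From mathcomp Require Import ring lra.
Import Order.TTheory GRing.Theory Num.Theory.
Import numFieldNormedType.Exports.

Set Implicit Arguments.
Unset Strict Implicit.
Unset Printing Implicit Defensive.

Local Open Scope classical_set_scope.
Local Open Scope ring_scope.

Local Notation hull := (@Defs.conv _ _).

(** * Strict convex combinations of two real numbers *)

Section ConvexCombination.
Context (R : realType).
Implicit Types a b c t : R.

Lemma conv_lb c a b t : c <= a -> c <= b -> 0 < t < 1 -> c <= t * a + (1 - t) * b.
Proof. nra. Qed.

(** This is what makes the locus where a linear form attains its lower bound a face: a strict
    mixture attains the bound only if both ends do. *)
Lemma conv_lb_eq c a b t : c <= a -> c <= b -> 0 < t < 1 ->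
  t * a + (1 - t) * b = c -> a = c /\ b = c.
Proof. by move=> ca cb t01 e; split; nra. Qed.

End ConvexCombination.

(** * Convex hulls, their extreme points and their finite generation *)

Section ConvexHull.
Context (R : realType) (V : lmodType R).
Implicit Types (A B C : set V) (x y v : V) (t : R) (s : seq V).

Lemma convex_setP C : convex_set C <->
  forall x y t, C x -> C y -> 0 < t < 1 -> C (t *: x + (1 - t) *: y).
Proof.
split=> [/convex_setW cC x y t Cx Cy /andP[t0 t1]|cC].
  have := cC x y (mem_set Cx) (mem_set Cy) (Itv01 (ltW t0) (ltW t1)).
  by move=> /(_ t0 t1)/set_mem.
apply/convex_setW => x y /set_mem Cx /set_mem Cy l l0 l1.
by apply/mem_set; apply: cC => //; rewrite l0 l1.
Qed.

Lemma hull_convex A x y t : hull A x -> hull A y -> 0 < t < 1 ->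
  hull A (t *: x + (1 - t) *: y).
Proof.
move=> Ax Ay t01 C CA; have /convex_setP cC := CA.1.
by apply: cC t01; [exact: Ax|exact: Ay].
Qed.

Lemma hull_incl A C :
  (forall x y t, C x -> C y -> 0 < t < 1 -> C (t *: x + (1 - t) *: y)) ->
  A `<=` C -> hull A `<=` C.
Proof. by move=> /convex_setP cC AC; exact: smallest_sub. Qed.

Lemma sub_hull A : A `<=` hull A.
Proof. exact: sub_gen_smallest. Qed.

Lemma hull_mono A B : A `<=` B -> hull A `<=` hull B.
Proof.
by move=> AB; apply: hull_incl; [exact: hull_convex|move=> x /AB; exact: sub_hull].
Qed.

Lemma hull_min A B : A `<=` hull B -> hull A `<=` hull B.
Proof. by move=> AB; apply: hull_incl => //; exact: hull_convex. Qed.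

Lemma hull_nonempty A x : hull A x -> A !=set0.
Proof.
move=> Ax; apply: contrapT => /nonemptyPn A0.
by apply: (@hull_incl A set0 _ _ x Ax) => //; rewrite A0.
Qed.

Lemma hull_shift A x : hull [set y + x | y in A] = [set y + x | y in hull A].
Proof.
apply/seteqP; split.
  apply: hull_incl => [_ _ t [y Ay <-] [z Az <-] t01|_ [y Ay <-]].
    exists (t *: y + (1 - t) *: z); first exact: hull_convex.
    by rewrite !scalerDr addrACA -scalerDl subrKC scale1r.
  by exists y => //; exact: sub_hull.
move=> _ [y Ay <-].
apply: (@hull_incl A [set y | hull [set y + x | y in A] (y + x)]) Ay
  => [{}y z t Ay Az t01|{}y Ay] /=.
  have -> : t *: y + (1 - t) *: z + x = t *: (y + x) + (1 - t) *: (z + x).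
    by rewrite !scalerDr addrACA -scalerDl subrKC scale1r.
  exact: hull_convex.
by apply: sub_hull; exists y.
Qed.

(** For the inclusion from right to left, fixing one summand turns addition into a translation, so
    convexity is used in one variable at a time. *)
Lemma hull_add A B :
  hull [set x + y | x in A & y in B] = [set x + y | x in hull A & y in hull B].
Proof.
apply/seteqP; split.
  apply: hull_incl => [_ _ t [x Ax [y By <-]] [x' Ax' [y' By' <-]] t01|_ [x Ax [y By <-]]].
    exists (t *: x + (1 - t) *: x'); first exact: hull_convex.
    exists (t *: y + (1 - t) *: y'); first exact: hull_convex.
    by rewrite !scalerDr addrACA.
  by exists x; [exact: sub_hull|exists y => //; exact: sub_hull].
move=> _ [x Ax [y By <-]].
set C := hull _.
have CAy z : hull A z -> forall w, B w -> C (z + w).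
  move=> Az w Bw.
  apply: (@hull_incl A [set z | C (z + w)]) Az => [a b t Ca Cb t01|a Aa] /=.
    have -> : t *: a + (1 - t) *: b + w = t *: (a + w) + (1 - t) *: (b + w).
      by rewrite !scalerDr addrACA -scalerDl subrKC scale1r.
    exact: hull_convex.
  by apply: sub_hull; exists a => //; exists w.
apply: (@hull_incl B [set w | C (x + w)]) By => [w w' t Cx Cz t01|w Bw] /=.
  have -> : x + (t *: w + (1 - t) *: w') = t *: (x + w) + (1 - t) *: (x + w').
    by rewrite !scalerDr addrACA -scalerDl subrKC scale1r.
  exact: hull_convex.
exact: CAy.
Qed.

(** The segments from [v] to [hull A], without the parameter value that gives [v] itself. Keeping
    [v] apart lets its extremality be read off from [hull_setU1]. *)
Definition cone_part v A : set V :=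
  [set x | exists2 y, hull A y & exists2 t, 0 <= t < 1 & x = t *: v + (1 - t) *: y].

(** Allowing [x = v] says more than convexity: a proper mixture of [v] with a point of
    [cone_part v A] stays in that set. *)
Lemma cone_part_convex v A x y t : x = v \/ cone_part v A x -> cone_part v A y ->
  0 < t < 1 -> cone_part v A (t *: x + (1 - t) *: y).
Proof.
move=> [->|[a Aa [p p01 ->]]] [b Ab [q q01 ->]] t01.
  exists b => //; exists (t + (1 - t) * q); first by nra.
  by rewrite scalerDr addrA !scalerA -scalerDl; congr (_ + _ *: _); ring.
set d := t * (1 - p) + (1 - t) * (1 - q).
have d0 : 0 < d by rewrite /d; nra.
(* [d] is the total weight falling on [hull A], and [r] is the share of [a] in it. *)
pose r := t * (1 - p) / d.
have r01 : 0 < r < 1 by rewrite divr_gt0 //= ?ltr_pdivrMr ?mul1r // /d; nra.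
exists (r *: a + (1 - r) *: b); first exact: hull_convex.
exists (t * p + (1 - t) * q); first by nra.
have -> : 1 - (t * p + (1 - t) * q) = d by rewrite /d; ring.
rewrite !scalerDr !scalerA addrACA -scalerDl.
have -> : d * r = t * (1 - p) by rewrite /r mulrC divfK ?gt_eqF.
have -> // : d * (1 - r) = (1 - t) * (1 - q).
by rewrite mulrBr mulr1 /r [d * _]mulrC divfK ?gt_eqF// /d; ring.
Qed.

Lemma hull_setU1 v A x : hull (v |` A) x -> x = v \/ cone_part v A x.
Proof.
move: x; apply: (@hull_incl _ [set x | x = v \/ cone_part v A x])
  => [x y t vx [->|Ay] t01|x [->|Ax]] /=.
- case: vx => [->|Ax]; first by left; rewrite -scalerDl subrKC scale1r.
  right; rewrite addrC -[t in t *: x](subKr 1).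
  by apply: cone_part_convex => //; [left|lra].
- by right; exact: cone_part_convex.
- by left.
right; exists x; first exact: sub_hull.
by exists 0; rewrite ?lexx ?ltr01// scale0r add0r subr0 scale1r.
Qed.

(* Removing an extreme point from a convex set leaves a convex set. *)
Lemma vertex_hull A v : vertex (hull A) v -> A v.
Proof.
move=> [Av ext]; apply: contrapT => nAv.
suff sub : hull A `<=` hull A `\ v by have [_ /(_ erefl)] := sub v Av.
apply: hull_incl => [x y t [Ax nx] [Ay ny] t01|x Ax].
  split; first exact: hull_convex.
  by move=> /= /esym /(ext x y t Ax Ay t01)[xv _]; exact: nx.
by split; [exact: sub_hull|move=> /= xv; apply: nAv; rewrite -xv].
Qed.

(** If [v] were in [cone_part v A], cancelling its multiple of [v] would put it in [hull A]. Hence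
    no open segment with an end in [cone_part v A] passes through [v]. *)
Lemma vertex_hull_setU1 v A : ~ hull A v -> vertex (hull (v |` A)) v.
Proof.
move=> nAv; have nv : ~ cone_part v A v.
  move=> [y Ay [t t01 e]]; apply: nAv; suff -> : v = y by [].
  apply: (@scalerI _ _ (1 - t)); first by rewrite gt_eqF//; lra.
  by rewrite scalerBl scale1r {1}e addrC addKr.
split=> [|x y t /hull_setU1 vx /hull_setU1[yv|Ay] t01 e]; first by apply: sub_hull; left.
  split=> //; case: vx => // Ax; exfalso; apply: nv; rewrite {2}e.
  have t01' : 0 < 1 - t < 1 by clear e; lra.
  by rewrite addrC -[t in t *: x](subKr 1); apply: cone_part_convex => //; left.
by exfalso; apply: nv; rewrite {2}e; exact: cone_part_convex.
Qed.

Lemma hull_vertices s : exists2 s' : seq V,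
  (forall v, v \in s' -> vertex (hull [set` s]) v) & hull [set` s] = hull [set` s'].
Proof.
have [m] := ubnP (size s); elim: m s => // m IH s /ltnSE sm.
have [/existsNP[v /not_implyP[vs nv]]|all_vertex] :=
  pselect (~ forall v, v \in s -> vertex (hull [set` s]) v); last first.
  by exists s => //; exact: contrapT.
pose A := [set` [seq x <- s | predC1 v x]].
have sE : [set` s] = v |` A.
  apply/seteqP; split=> x /=.
    have [->|xv] := eqVneq x v; first by left.
    by right; rewrite /A /= mem_filter /= xv.
  by case=> [->//|]; rewrite /A /= mem_filter => /andP[].
have Av : hull A v.
  by apply: contrapT => /vertex_hull_setU1; rewrite -sE.
have e : hull [set` s] = hull A.
  apply/seteqP; split; rewrite sE.
    by apply: hull_min => x [->|/sub_hull].
  by apply: hull_mono => x; right.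
rewrite e; apply: IH; apply: leq_trans sm.
rewrite size_filter -(count_predC (predC1 v)) -[X in (X < _)%N]addn0 ltn_add2l.
by rewrite -has_count; apply/hasP; exists v => //=; rewrite negbK.
Qed.

(** The total weight appears as a factor and not as a divisor, so that it may vanish; in that case
    the nonemptiness of [A] supplies [y]. *)
Lemma hull_sum (I : eqType) (r : seq I) (c : I -> R) (p : I -> V) A :
  A !=set0 -> (forall i, i \in r -> 0 <= c i /\ hull A (p i)) ->
  exists2 y, hull A y & \sum_(i <- r) c i *: p i = (\sum_(i <- r) c i) *: y.
Proof.
move=> [x0 Ax0]; elim: r => [|i r IH] h.
  by exists x0; [exact: sub_hull|rewrite !big_nil scale0r].
have [i0 Ap] := h i (mem_head _ _).
have [j jr|y Ay e] := IH; first by apply: h; rewrite in_cons jr orbT.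
rewrite !big_cons e.
have s0 : 0 <= \sum_(j <- r) c j.
  by rewrite big_seq sumr_ge0 // => j jr; have [] := h j; rewrite // in_cons jr orbT.
move: (\sum_(j <- r) c j) s0 => b b0 in e *.
have [a0|a0] := eqVneq (c i) 0; first by exists y; rewrite // a0 scale0r !add0r.
have [->|b0'] := eqVneq b 0; first by exists (p i); rewrite // scale0r !addr0.
have {a0}a0 : 0 < c i by rewrite lt_def a0.
have {b0'}b0 : 0 < b by rewrite lt_def b0'.
have d0 : 0 < c i + b by rewrite addr_gt0.
exists (c i / (c i + b) *: p i + (1 - c i / (c i + b)) *: y).
  apply: hull_convex => //.
  by rewrite divr_gt0 //= ltr_pdivrMr// mul1r ltrDl.
rewrite scalerDr !scalerA mulrBr mulr1 !(mulrC (_ + _)) divfK ?gt_eqF//.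
by rewrite addrAC subrr add0r.
Qed.

End ConvexHull.

(** * The pairing, separation from a polytope, and polar duality *)

Section Pairing.
Context (R : realType) (n : nat).
Implicit Types (x y u v : 'rV[R]_n) (t : R).

Lemma pairingE x y : pairing x y = \sum_j x 0 j * y 0 j.
Proof. by rewrite /pairing mxE; apply: eq_bigr => j _; rewrite mxE. Qed.

Lemma pairingC x y : pairing x y = pairing y x.
Proof. by rewrite !pairingE; apply: eq_bigr => j _; rewrite mulrC. Qed.

Lemma pairingDl x y u : pairing (x + y) u = pairing x u + pairing y u.
Proof. by rewrite /pairing mulmxDl mxE. Qed.

Lemma pairingZl t x u : pairing (t *: x) u = t * pairing x u.
Proof. by rewrite /pairing -scalemxAl mxE. Qed.

Lemma pairingNl x u : pairing (- x) u = - pairing x u.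
Proof. by rewrite -scaleN1r pairingZl mulN1r. Qed.

Lemma pairing0l u : pairing 0 u = 0.
Proof. by rewrite /pairing mul0mx mxE. Qed.

Lemma pairingDr x y u : pairing u (x + y) = pairing u x + pairing u y.
Proof. by rewrite !(pairingC u) pairingDl. Qed.

Lemma pairingZr t x u : pairing u (t *: x) = t * pairing u x.
Proof. by rewrite !(pairingC u) pairingZl. Qed.

Lemma pairingNr x u : pairing u (- x) = - pairing u x.
Proof. by rewrite !(pairingC u) pairingNl. Qed.

Lemma pairing0r u : pairing u 0 = 0.
Proof. by rewrite pairingC pairing0l. Qed.

Lemma pairing_suml (I : Type) (r : seq I) (P : pred I) (f : I -> 'rV[R]_n) u :
  pairing (\sum_(i <- r | P i) f i) u = \sum_(i <- r | P i) pairing (f i) u.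
Proof.
by elim/big_rec2: _ => [|i a b _ <-]; rewrite (pairing0l, pairingDl).
Qed.

Lemma pairing_sumr (I : Type) (r : seq I) (P : pred I) (f : I -> 'rV[R]_n) u :
  pairing u (\sum_(i <- r | P i) f i) = \sum_(i <- r | P i) pairing u (f i).
Proof. by rewrite pairingC pairing_suml; apply: eq_bigr => i _; rewrite pairingC. Qed.

Lemma pairing_sqrD x y :
  pairing (x + y) (x + y) = pairing x x + 2 * pairing y x + pairing y y.
Proof. by rewrite pairingDl !pairingDr (pairingC x y); ring. Qed.

Lemma pairing_gt0 x : x != 0 -> 0 < pairing x x.
Proof.
move=> x0; rewrite lt_def pairingE sumr_ge0 => [|j _]; last by rewrite -expr2 sqr_ge0.
rewrite andbT psumr_neq0 => [|j _]; last by rewrite -expr2 sqr_ge0.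
have /rV0Pn[j xj] := x0; apply/hasP; exists j; rewrite ?mem_index_enum//=.
by rewrite -expr2 lt_def sqr_ge0 expf_eq0 /= xj.
Qed.

Lemma pairing_continuous (T : topologicalType) (f g : T -> 'rV[R]_n) :
  continuous f -> continuous g -> continuous (fun p => pairing (f p) (g p)).
Proof.
move=> cf cg p.
rewrite (_ : (fun p => _) = fun p => \sum_j f p 0 j * g p 0 j); last first.
  by apply/funext => q; rewrite pairingE.
apply: cvg_big => [|j _]; first exact: add_continuous.
have cj : continuous (fun M : 'rV[R]_n => M 0 j) by exact: coord_continuous.
apply: cvgM.
  exact: (@continuous_comp _ _ _ f (fun M : 'rV[R]_n => M 0 j) p (cf p) (cj _)).
exact: (@continuous_comp _ _ _ g (fun M : 'rV[R]_n => M 0 j) p (cg p) (cj _)).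
Qed.

Lemma pairing_row_mx m (a : 'rV[R]_m) (b x : 'rV[R]_n) (y : 'rV[R]_m) :
  pairing (row_mx a b) (row_mx y x) = pairing a y + pairing b x.
Proof. by rewrite /pairing tr_row_mx mul_row_col mxE. Qed.

Lemma hull_pairing_ge (A : set 'rV[R]_n) u c :
  (forall x, A x -> c <= pairing x u) -> forall x, hull A x -> c <= pairing x u.
Proof.
move=> Ac; apply: (@hull_incl _ _ A [set x | c <= pairing x u]) => // x y t /= cx cy t01.
rewrite pairingDl !pairingZl; nra.
Qed.

Lemma polar_hull (A : set 'rV[R]_n) : polar (hull A) = polar A.
Proof.
apply/seteqP; split=> y Ay x Ax; first by apply: Ay; exact: sub_hull.
exact: hull_pairing_ge Ay x Ax.
Qed.

Lemma hull_seq_min (s : seq 'rV[R]_n) u : hull [set` s] !=set0 ->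
  exists2 v, v \in s & forall x, hull [set` s] x -> pairing v u <= pairing x u.
Proof.
move=> [x /hull_nonempty s0].
suff [v vs vmin] : exists2 v, v \in s & forall x, x \in s -> pairing v u <= pairing x u.
  by exists v => //; apply: hull_pairing_ge => z; exact: vmin.
elim: s s0 {x} => [[]//|a s IH _].
case: s IH => [_|b s IH]; first by exists a; rewrite ?mem_head// => x; rewrite inE => /eqP->.
have [|v vs vmin] := IH; first by exists b => /=; rewrite mem_head.
have [av|/ltW va] := leP (pairing a u) (pairing v u).
  exists a; first exact: mem_head.
  by move=> x; rewrite in_cons => /predU1P[->//|/vmin]; exact: le_trans.
exists v; first by rewrite in_cons vs orbT.
by move=> x; rewrite in_cons => /predU1P[->|/vmin].
Qed.

(** Induction on the generators: over a nonempty hull, adding [a] gives the image of the product of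
    [[0, 1]] with that hull under the continuous map [(t, y) |-> t a + (1 - t) y]. *)
Lemma hull_seq_compact (s : seq 'rV[R]_n) : compact (hull [set` s]).
Proof.
elim: s => [|a s IH].
  rewrite (_ : hull _ = set0); first exact: compact0.
  by apply/seteqP; split=> // x /hull_nonempty[].
have sE : [set` a :: s] = a |` [set` s].
  apply/seteqP; split=> x /=; rewrite in_cons; first by move=> /predU1P[->|]; [left|right].
  by case=> [->|->]; rewrite ?eqxx ?orbT.
rewrite sE.
have [[x0 sx0]|/nonemptyPn s0] := pselect (hull [set` s] !=set0); last first.
  rewrite (_ : hull _ = [set a]); first exact: compact_set1.
  apply/seteqP; split=> [x /hull_setU1[//|[y]]|x ->]; first by rewrite s0.
  by apply: sub_hull; left.
pose f (p : R * 'rV[R]_n) := p.1 *: a + (1 - p.1) *: p.2.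
rewrite (_ : hull _ = f @` (`[0, 1]%classic `*` hull [set` s])).
  apply: continuous_compact; last by apply: compact_setX => //; exact: segment_compact.
  apply: continuous_subspaceT => p; apply: cvgD; apply: cvgZ.
  - exact: cvg_fst.
  - exact: cvg_cst.
  - by apply: cvgB; [exact: cvg_cst|exact: cvg_fst].
  - exact: cvg_snd.
apply/seteqP; split=> [x /hull_setU1[->|[y sy [t /andP[t0 t1] ->]]]|_ [[t y] /= [] /= t01 sy <-]].
- exists (1, x0); rewrite /f /= ?in_itv/= ?lexx ?ler01 ?scale1r ?subrr ?scale0r ?addr0//.
- by exists (t, y) => //=; rewrite in_itv /= t0 ltW.
have ah : hull (a |` [set` s]) a by apply: sub_hull; left.
have yh : hull (a |` [set` s]) y by apply: hull_mono sy => z; right.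
move: t01; rewrite in_itv /= /f /= => /andP[].
rewrite le_eqVlt => /predU1P[<- _|t0]; first by rewrite scale0r add0r subr0 scale1r.
rewrite le_eqVlt => /predU1P[->|t1]; first by rewrite subrr scale0r addr0 scale1r.
by apply: hull_convex; rewrite ?t0.
Qed.

(* With [z] the point of the hull nearest to [x], the normal is [z - x]. *)
Lemma hull_seq_separation (s : seq 'rV[R]_n) x : hull [set` s] !=set0 ->
  ~ hull [set` s] x -> exists y, exists2 c, pairing x y < c &
    forall v, hull [set` s] v -> c <= pairing v y.
Proof.
move=> s0 sx; pose f z := pairing (z - x) (z - x).
have [|z /set_mem sz zmin] := compact_EVT_min (f := f) s0 (@hull_seq_compact s).
  have cB : continuous (fun z : 'rV[R]_n => z - x).
    by move=> z; exact: (cvgB (@cvg_id _ (nbhs z)) (cvg_cst x)).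
  by apply: continuous_subspaceT; exact: pairing_continuous.
have zx : z - x != 0 by rewrite subr_eq0; apply/eqP => e; apply: sx; rewrite -e.
have := pairing_gt0 zx; set d := pairing _ _ => d0.
exists (z - x), (pairing z (z - x)).
  by rewrite -subr_gt0 -pairingNl -pairingDl.
move=> v sv; rewrite -subr_ge0 -pairingNl -pairingDl.
set p := pairing _ _; rewrite leNgt; apply/negP => p0.
set q := pairing (v - z) (v - z).
have q0 : 0 <= q.
  by rewrite /q; have [->|/pairing_gt0/ltW//] := eqVneq (v - z) 0; rewrite pairing0l.
(* Minimality of the distance at [z], tested along the segment from [z] to [v]. *)
have key t : 0 < t < 1 -> 0 <= t * (2 * p + t * q).
  move=> t01; have := zmin (t *: v + (1 - t) *: z) (mem_set (hull_convex sv sz t01)).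
  rewrite /f -/d; have -> : t *: v + (1 - t) *: z - x = (z - x) + t *: (v - z).
    by rewrite scalerBl scale1r scalerBr addrCA addrAC.
  rewrite pairing_sqrD pairingZl pairingZr pairingZl -/q -/p -/d; lra.
(* This [t] lies strictly between 0 and 1 and is small enough to make [2 * p + t * q] negative,
   against [key]. *)
pose t := - p / (q - p + 1 - p).
have e0 : 0 < q - p + 1 - p by lra.
have t01 : 0 < t < 1 by rewrite divr_gt0 ?oppr_gt0//= ltr_pdivrMr// mul1r; lra.
have := key t t01; have et : t * (q - p + 1 - p) = - p by rewrite divfK// gt_eqF.
by move: t01 et; clearbody t; nra.
Qed.

Lemma bipolar_hull_seq (s : seq 'rV[R]_n) : hull [set` s] 0 ->
  polar (polar (hull [set` s])) = hull [set` s].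
Proof.
move=> s0; apply/seteqP; split=> [x sx|x sx y sy]; last by rewrite pairingC; exact: sy.
apply: contrapT => nsx.
have [|y [c xc cs]] := hull_seq_separation _ nsx; first by exists 0.
have c0 : c <= 0 by have := cs 0 s0; rewrite pairing0l.
(* The bound [c] may be 0, but the midpoint [d] is strictly negative; [y] divided by [- d] then lies
   in the polar and pairs with [x] below -1. *)
pose d := (c + pairing x y) / 2.
have d0 : d < 0 by rewrite /d; lra.
have /sx : polar (hull [set` s]) ((- d)^-1 *: y).
  move=> v sv; rewrite pairingZr mulrC ler_pdivlMr ?oppr_gt0// mulN1r opprK.
  by apply: le_trans (cs v sv); rewrite /d; lra.
rewrite pairingC pairingZr mulrC ler_pdivlMr ?oppr_gt0// mulN1r opprK /d; lra.
Qed.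

(** Each generator imposes one inequality, strict at 0 and hence valid near 0; finitely many
    neighbourhoods are intersected. *)
Lemma polar_hull_seq_interior (s : seq 'rV[R]_n) : interior (polar (hull [set` s])) 0.
Proof.
rewrite polar_hull /interior.
elim: s => [|a s IH]; first by apply: filterS filterT => y _ x.
have ca : continuous (pairing a).
  have ida : continuous (@id 'rV[R]_n) by move=> y; exact: cvg_id.
  exact: (@pairing_continuous _ (fun=> a) id (@cst_continuous _ _ a) ida).
have : \forall y \near (0 : 'rV[R]_n), -1 < pairing a y.
  by apply: (cvgr_gt _ (ca 0)); rewrite pairing0r ltrN10.
move=> h; apply: filterS2 IH h => y sy /ltW ay x /=.
by rewrite in_cons => /predU1P[->//|]; exact: sy.
Qed.

(** A small negative multiple of [u] lies in [A], and it pairs negatively with [u] unless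
    [u = 0]. *)
Lemma interior_pairing_ge0 (A : set 'rV[R]_n) u : interior A 0 ->
  (forall x, A x -> 0 <= pairing x u) -> u = 0.
Proof.
move=> A0 Au; apply/eqP; apply: contraT => /pairing_gt0 u0.
have /(_ 0) /= h : continuous (fun t : R => t *: - u) by exact: scalel_continuous.
have : \forall t \near (0:R), A (t *: - u) by apply: h; rewrite scale0r.
move=> /nbhs_ballP[e /= e0 /(_ (e / 2))] H.
have /H/Au : ball (0 : R) e (e / 2).
  by rewrite /ball /= sub0r normrN ger0_norm; lra.
rewrite pairingZl pairingNl; nra.
Qed.

End Pairing.

(** * Closure properties of lattice points *)

Section LatticePoint.
Context (R : realType) (n : nat).
Implicit Types x y : 'rV[R]_n.

Lemma lattice_point0 : lattice_point (0 : 'rV[R]_n).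
Proof. by apply/mxOverP => i j; rewrite mxE; exact: rpred0. Qed.

Lemma lattice_pointD x y :
  lattice_point x -> lattice_point y -> lattice_point (x + y).
Proof.
move=> /mxOverP xl /mxOverP yl; apply/mxOverP => i j.
by rewrite mxE; exact: rpredD (xl i j) (yl i j).
Qed.

Lemma lattice_pointZ (a : R) x :
  a \is a Num.int -> lattice_point x -> lattice_point (a *: x).
Proof. by move=> aint /mxOverP xl; apply/mxOverP => i j; rewrite mxE; exact: rpredM. Qed.

Lemma lattice_pointN x : lattice_point x -> lattice_point (- x).
Proof. by move=> xl; rewrite -scaleN1r; apply: lattice_pointZ xl; rewrite rpredN rpred1. Qed.

Lemma lattice_point_sum (I : Type) (r : seq I) (P : pred I) (f : I -> 'rV[R]_n) :
  (forall i, P i -> lattice_point (f i)) -> lattice_point (\sum_(i <- r | P i) f i).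
Proof.
by move=> fl; apply: (big_ind (@lattice_point R n)) => //;
  [exact: lattice_point0|exact: lattice_pointD].
Qed.

Lemma lattice_point_row_mx m x (a : 'rV[R]_m) :
  lattice_point x -> lattice_point a -> lattice_point (row_mx x a).
Proof.
move=> /mxOverP xl /mxOverP al; apply/mxOverP => i j.
by rewrite mxE; case: splitP.
Qed.

Lemma lattice_pairing x y : lattice_point x -> lattice_point y ->
  pairing x y \is a Num.int.
Proof.
move=> /mxOverP xl /mxOverP yl; rewrite pairingE rpred_sum// => j _.
by rewrite rpredM.
Qed.

End LatticePoint.

(** * Lattice polytopes under sums, joint hulls and translations *)

Section LatticePolytope.
Context (R : realType) (n : nat).
Implicit Types (s : seq 'rV[R]_n) (P : set 'rV[R]_n).

(** Generators can be cut down to extreme points, and extreme points are among any generators.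
    Integrality may thus be checked on any finite generating list. *)
Lemma lattice_polytopeP P : lattice_polytope P <->
  exists2 s : seq 'rV[R]_n, {in s, forall v, lattice_point v} & P = hull [set` s].
Proof.
split=> [[[s ->] vl]|[s sl ->]].
  by have [s' s'v e] := hull_vertices s; exists s' => // v /s'v/vl.
split; first by exists s.
by move=> v /vertex_hull; exact: sl.
Qed.

Lemma minkowski_sum0 (V : lmodType R) (P : 'I_0 -> set V) : minkowski_sum P = [set 0].
Proof.
apply/seteqP; split=> [_ [f _ ->]|_ ->]; first by rewrite big_ord0.
by exists (fun=> 0); [case|rewrite big_ord0].
Qed.

Lemma minkowski_sumS (V : lmodType R) m (P : 'I_m.+1 -> set V) :
  minkowski_sum P =
  [set x + y | x in P ord0 & y in minkowski_sum (fun i => P (lift ord0 i))].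
Proof.
apply/seteqP; split=> [_ [f Pf ->]|_ [x Px [_ [f Pf ->] <-]]].
  exists (f ord0) => //; exists (\sum_i f (lift ord0 i)); last by rewrite big_ord_recl.
  by exists (fun i => f (lift ord0 i)).
exists (fun i => if unlift ord0 i is Some j then f j else x).
  by move=> i; case: unliftP => [j ->|->].
by rewrite big_ord_recl unlift_none; congr (_ + _); apply: eq_bigr => i _; rewrite liftK.
Qed.

Lemma lattice_polytope_minkowski_sum m (P : 'I_m -> set 'rV[R]_n) :
  (forall i, lattice_polytope (P i)) -> lattice_polytope (minkowski_sum P).
Proof.
elim: m P => [|m IH] P Pl.
  rewrite minkowski_sum0; apply/lattice_polytopeP; exists [:: 0].
    by move=> v; rewrite inE => /eqP->; exact: lattice_point0.
  apply/seteqP; split=> [_ ->|]; first by apply: sub_hull; rewrite /= mem_head.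
  apply: hull_incl => [x y t -> -> _|x /=]; last by rewrite inE => /eqP.
  by rewrite !scaler0 addr0.
have /lattice_polytopeP[s sl se] := Pl ord0.
have /lattice_polytopeP[s' sl' se'] := IH _ (fun i => Pl (lift ord0 i)).
rewrite minkowski_sumS se se' -hull_add; apply/lattice_polytopeP.
exists [seq x + y | x <- s, y <- s'].
  move=> _ /allpairsP[[x y] /= [/sl xl /sl' yl ->]].
  exact: lattice_pointD.
congr hull; apply/seteqP; split=> [_ [x /= xs [y /= ys <-]]|_ /allpairsP[[x y] /= [xs ys ->]]].
  by apply/allpairsP; exists (x, y).
by exists x => //; exists y.
Qed.

Lemma lattice_polytope_uplus m (P : 'I_m -> set 'rV[R]_n) :
  (forall i, lattice_polytope (P i)) -> lattice_polytope (uplus P).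
Proof.
move=> Pl.
have /choice[s sP] : forall i, exists s : seq 'rV[R]_n,
    {in s, forall v, lattice_point v} /\ P i = hull [set` s].
  by move=> i; have /lattice_polytopeP[s sl se] := Pl i; exists s.
apply/lattice_polytopeP; exists (flatten [seq s i | i : 'I_m]).
  by move=> v /flatten_mapP[i _ vs]; have [sl _] := sP i; exact: sl.
apply/seteqP; split; apply: hull_min => v.
  move=> [i _]; have [_ ->] := sP i; apply: hull_mono => x xs.
  by apply/flatten_mapP; exists i => //; rewrite mem_enum.
move=> /flatten_mapP[i _ vs]; apply: sub_hull; exists i => //.
by have [_ ->] := sP i; exact: sub_hull.
Qed.

Lemma lattice_polytope_shift P (a : 'rV[R]_n) : lattice_point a ->
  lattice_polytope P -> lattice_polytope [set y + a | y in P].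
Proof.
move=> al /lattice_polytopeP[s sl ->]; apply/lattice_polytopeP.
exists [seq y + a | y <- s].
  by move=> _ /mapP[y /sl yl ->]; exact: lattice_pointD.
rewrite -hull_shift; congr hull; apply/seteqP; split=> [_ [y ys <-]|_ /mapP[y ys ->]].
  exact: map_f.
by exists y.
Qed.

Lemma bipolar_lattice_polytope P : lattice_polytope P -> P 0 -> polar (polar P) = P.
Proof. by move=> [[s ->] _]; exact: bipolar_hull_seq. Qed.

End LatticePolytope.

(** * The vectors of the added summand and their pairings *)

Section CayleyVectors.
Context (R : realType) (n k : nat).
Local Notation W := 'rV[R]_(n + k).
Local Notation e i := (@e_vec R n k i).

(* [e_dual ord0 = 0] and [e_dual (lift ord0 l)] is the paper's e*_(l+1), so that
   nabla_j is the translate of nabla_0 by [- e_dual j] for every [j]. *)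
Definition e_dual (j : 'I_k.+1) : W :=
  if unlift ord0 j is Some l then @basis_vec R n k l else 0.

Lemma e_dual0 : e_dual ord0 = 0.
Proof. by rewrite /e_dual unlift_none. Qed.

Lemma e_dualS l : e_dual (lift ord0 l) = @basis_vec R n k l.
Proof. by rewrite /e_dual liftK. Qed.

Lemma e_vec0 : e ord0 = - \sum_l @basis_vec R n k l.
Proof. by rewrite /e_vec unlift_none. Qed.

Lemma e_vecS l : e (lift ord0 l) = @basis_vec R n k l.
Proof. by rewrite /e_vec liftK. Qed.

Lemma sum_e_vec : \sum_i e i = 0.
Proof.
by rewrite big_ord_recl e_vec0 (eq_bigr _ (fun l _ => e_vecS l)) addNr.
Qed.

Lemma pairing_basis_vec (l l' : 'I_k) :
  pairing (@basis_vec R n k l) (@basis_vec R n k l') = (l == l')%:R.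
Proof.
rewrite pairing_row_mx pairing0l add0r pairingE (bigD1 l) //= big1 => [|j jl].
  by rewrite !mxE !eqxx mulr_natl mulr1n addr0.
by rewrite mxE (negPf jl) andbF mul0r.
Qed.

(** The subtracted term accounts both for [e_0], which pairs to -1 with every [e*_l], and for
    [e_dual ord0 = 0]. *)
Lemma pairing_e_dual i j :
  pairing (e i) (e_dual j) = (i == j)%:R - (i == ord0)%:R.
Proof.
case: (unliftP ord0 j) => [l ->|->]; last by rewrite e_dual0 pairing0r subrr.
rewrite e_dualS; case: (unliftP ord0 i) => [l' ->|->].
  by rewrite e_vecS pairing_basis_vec (inj_eq lift_inj) subr0.
rewrite e_vec0 pairingNl pairing_suml (bigD1 l) //= pairing_basis_vec eqxx.
rewrite big1 => [|l' /negPf ll']; first by rewrite addr0 sub0r.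
by rewrite pairing_basis_vec ll'.
Qed.

Lemma pairing_row0_basis_vec (m : 'rV[R]_n) l :
  pairing (row_mx m 0) (@basis_vec R n k l) = 0.
Proof. by rewrite pairing_row_mx pairing0r pairing0l addr0. Qed.

Lemma pairing_row0_e_dual (m : 'rV[R]_n) j : pairing (row_mx m 0) (e_dual j) = 0.
Proof.
by rewrite /e_dual; case: unlift => [l|]; rewrite (pairing0r, pairing_row0_basis_vec).
Qed.

Lemma pairing_e_row0 i (u : 'rV[R]_n) : pairing (e i) (row_mx u 0) = 0.
Proof.
case: (unliftP ord0 i) => [l ->|->].
  by rewrite e_vecS pairingC pairing_row0_basis_vec.
rewrite e_vec0 pairingNl pairing_suml big1 ?oppr0// => l _.
by rewrite pairingC pairing_row0_basis_vec.
Qed.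

Lemma pairing_gen_e_dual (m : 'rV[R]_n) i j :
  pairing (row_mx m 0 + e i) (e_dual j) = (i == j)%:R - (i == ord0)%:R.
Proof. by rewrite pairingDl pairing_row0_e_dual add0r pairing_e_dual. Qed.

Lemma pairing_gen_sum_e_dual (m : 'rV[R]_n) i (c : 'I_k.+1 -> R) :
  pairing (row_mx m 0 + e i) (\sum_j c j *: e_dual j) =
  c i - (i == ord0)%:R * \sum_j c j.
Proof.
rewrite pairing_sumr.
under eq_bigr do rewrite pairingZr pairing_gen_e_dual mulrBr.
rewrite sumrB -mulr_suml mulrC (bigD1 i) //= eqxx mulr1 big1 ?addr0 1?mulrC//.
by move=> j /negPf ji; rewrite eq_sym ji mulr0.
Qed.

Lemma pairing_gen_row0 (m u : 'rV[R]_n) i :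
  pairing (row_mx m 0 + e i) (row_mx u 0) = pairing m u.
Proof. by rewrite pairingDl pairing_e_row0 addr0 pairing_row_mx pairing0l addr0. Qed.

(** The term at [ord0] vanishes with [e_dual ord0]; the other coefficients are the last [k]
    coordinates of [y]. *)
Lemma row0_sum_e_dual (y : W) :
  y = row_mx (lsubmx y) 0 + \sum_j pairing (e j) y *: e_dual j.
Proof.
rewrite big_ord_recl e_dual0 scaler0 add0r.
under eq_bigr do rewrite e_dualS e_vecS.
rewrite -[LHS]hsubmxK -[X in _ = X + _]addr0.
have -> : \sum_l pairing (@basis_vec R n k l) y *: @basis_vec R n k l =
    row_mx 0 (rsubmx y).
  rewrite [in RHS](row_sum_delta (rsubmx y)).
  rewrite (big_morph (fun a => row_mx (0 : 'rV[R]_n) a) (id1 := 0) (op1 := +%R)).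
  - apply: eq_bigr => l _; rewrite scale_row_mx scaler0; congr (row_mx _ (_ *: _)).
    rewrite -[in LHS](hsubmxK y) pairing_row_mx pairing0l add0r pairingE (bigD1 l) //=.
    rewrite big1 => [|j /negPf jl]; first by rewrite !mxE !eqxx mul1r addr0.
    by rewrite [delta_mx _ _ _ _]mxE jl andbF mul0r.
  - by move=> a b; rewrite add_row_mx addr0.
  - by rewrite row_mx0.
by rewrite addr0 add_row_mx addr0 add0r.
Qed.

Lemma lattice_point_basis_vec l : lattice_point (@basis_vec R n k l).
Proof.
apply: lattice_point_row_mx; first exact: lattice_point0.
by apply/mxOverP => i j; rewrite mxE; case: (_ && _); rewrite ?rpred1 ?rpred0.
Qed.

Lemma lattice_point_e_dual j : lattice_point (e_dual j).
Proof.
rewrite /e_dual; case: unlift => [l|]; last exact: lattice_point0.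
exact: lattice_point_basis_vec.
Qed.

Lemma lattice_point_e_vec i : lattice_point (e i).
Proof.
rewrite /e_vec; case: unlift => [l|]; first exact: lattice_point_basis_vec.
by apply: lattice_pointN; apply: lattice_point_sum => l _; exact: lattice_point_basis_vec.
Qed.

Lemma nabla_hatE (D : set 'rV[R]_n) (Ds : 'I_k.+1 -> set 'rV[R]_n) j :
  nabla_hat D Ds j = [set y - e_dual j | y in nabla_hat0 D Ds].
Proof.
rewrite /nabla_hat /e_dual; case: unlift => [l//|].
apply/seteqP; split=> [y Dy|_ [y Dy <-]]; last by rewrite subr0.
by exists y; rewrite ?subr0.
Qed.

End CayleyVectors.

(** An exhibited minimiser rules out the default value of [xget], and antisymmetry makes the minimum
    unique. *)
Lemma min_pairingE (R : realType) (n : nat) (P : set 'rV[R]_n) u m :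
  P m -> (forall x, P x -> pairing m u <= pairing x u) ->
  min_pairing P u = pairing m u.
Proof.
move=> Pm mmin; rewrite /min_pairing.
have mP : is_min [set pairing x u | x in P] (pairing m u).
  by split=> [|_ [x Px <-]]; [exists m|exact: mmin].
have [[x Px <-] xmin] := xgetPex 0 (ex_intro _ _ mP).
by apply/eqP; rewrite eq_le mmin// xmin//; exists m.
Qed.

(** * The two polar identities for the dual polytopes of the lifted summands *)

Section Duality.
Context (R : realType) (n k : nat) (Ds : 'I_k.+1 -> set 'rV[R]_n).
Context (Ds_lattice : forall i, lattice_polytope (Ds i)).
Local Notation D := (minkowski_sum Ds).
Local Notation W := 'rV[R]_(n + k).
Local Notation e i := (@e_vec R n k i).
Local Notation E := (@e_dual R n k).
Local Notation T := (Delta_tilde Ds).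

Lemma nef_dual_tildeP j (y : W) : nef_dual T j y <->
  forall i m, Ds i m -> - (i == j)%:R <= pairing (row_mx m 0 + e i) y.
Proof.
split=> [Ty i m Dm|Dy i].
  by apply: Ty; apply: sub_hull; left; exists m.
apply: hull_pairing_ge => _ [[m Dm <-]|->]; first exact: Dy.
by rewrite pairing0l oppr_le0.
Qed.

(** Adding [E j] changes the value on a generator [m + e_i] by [(i == j) - (i == ord0)], exactly the
    difference between the two bounds. *)
Lemma nef_dual_tilde_shift j (y : W) :
  nef_dual T j y <-> nef_dual T ord0 (y + E j).
Proof.
rewrite !nef_dual_tildeP; split=> h i m /h; rewrite pairingDr pairing_gen_e_dual; lra.
Qed.

Lemma polar_uplus_tildeP (y : W) : polar (uplus T) y <->
  forall i m, Ds i m -> -1 <= pairing (row_mx m 0 + e i) y.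
Proof.
rewrite /uplus polar_hull; split=> [Ty i m Dm|Dy x [i _]].
  by apply: Ty; exists i => //; apply: sub_hull; left; exists m.
apply: hull_pairing_ge => _ [[m Dm <-]|->]; first exact: Dy.
by rewrite pairing0l oppr_le0.
Qed.

(** Adding the weighted sum of the [E j] cancels [- c i] in each bound and leaves minus the total
    weight at [i = ord0] only; dividing by the total normalises it to -1. *)
Lemma nef_dual0_weighted (c : 'I_k.+1 -> R) (y : W) : 0 < \sum_j c j ->
  (forall i m, Ds i m -> - c i <= pairing (row_mx m 0 + e i) y) ->
  nef_dual T ord0 ((\sum_j c j)^-1 *: (y + \sum_j c j *: E j)).
Proof.
move=> c0 yc; apply/nef_dual_tildeP => i m /yc yi.
rewrite pairingZr pairingDr pairing_gen_sum_e_dual mulrC ler_pdivlMr//; lra.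
Qed.

Lemma weighted_decomposition (c : 'I_k.+1 -> R) (y : W) : \sum_j c j != 0 ->
  y = \sum_j c j *: ((\sum_j c j)^-1 *: (y + \sum_j c j *: E j) - E j).
Proof.
move=> c0; under [RHS]eq_bigr do rewrite scalerBr.
by rewrite sumrB -scaler_suml scalerA mulfV// scale1r addrK.
Qed.

Lemma polar_uplus_tilde : polar (uplus T) = minkowski_sum (nef_dual T).
Proof.
apply/seteqP; split=> [y /polar_uplus_tildeP Ty|_ [f Nf ->]]; last first.
  apply/polar_uplus_tildeP => i m Dm; rewrite pairing_sumr.
  apply: le_trans (ler_sum _ (fun j _ => (nef_dual_tildeP j (f j)).1 (Nf j) i m Dm)).
  rewrite sumrN (bigD1 i) //= eqxx big1 ?addr0// => j /negPf ji.
  by rewrite eq_sym ji.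
have s0 : 0 < \sum_(j < k.+1) (1 : R) by rewrite sumr_const card_ord ltr0n.
have := nef_dual0_weighted s0 Ty; set z := _ *: _ => Nz.
exists (fun j => z - E j) => [j|]; first by apply/nef_dual_tilde_shift; rewrite subrK.
rewrite {1}(@weighted_decomposition (fun=> 1) y) ?gt_eqF//.
by apply: eq_bigr => j _; rewrite scale1r.
Qed.

Lemma lattice_polytope_tilde i : lattice_polytope (T i).
Proof.
have /lattice_polytopeP[s sl se] := Ds_lattice i.
apply/lattice_polytopeP; exists (0 :: [seq row_mx x 0 + e i | x <- s]).
  move=> v; rewrite in_cons => /predU1P[->|/mapP[x /sl xl ->]]; first exact: lattice_point0.
  apply: lattice_pointD; last exact: lattice_point_e_vec.
  by apply: lattice_point_row_mx => //; exact: lattice_point0.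
apply/seteqP; split; apply: hull_min => x /=; last first.
  rewrite in_cons => /predU1P[->|/mapP[y ys ->]]; apply: sub_hull; [by right|left].
  by exists y => //; rewrite se; exact: sub_hull.
case=> [[y]|->]; last by apply: sub_hull; rewrite /= mem_head.
rewrite se => ys <-; set C := hull _.
(* The lift is affine, so the points whose lift is in [C] form a convex set. *)
apply: (@hull_incl _ _ _ [set y | C (row_mx y 0 + e i)] _ _ y ys) => [a b t Ca Cb t01|a sa] /=.
  have -> : row_mx (t *: a + (1 - t) *: b) 0 + e i =
      t *: (row_mx a 0 + e i) + (1 - t) *: (row_mx b 0 + e i).
    rewrite !scalerDr addrACA -scalerDl subrKC scale1r !scale_row_mx add_row_mx.
    by rewrite !scaler0 addr0.
  exact: hull_convex.
by apply: sub_hull; apply/orP; right; exact: (map_f (fun x => row_mx x 0 + e i)).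
Qed.

Lemma tilde0 i : T i 0.
Proof. by apply: sub_hull; right. Qed.
Arguments tilde0 : clear implicits.

Lemma polar_uplus_nef_dual : polar (uplus (nef_dual T)) = minkowski_sum T.
Proof.
apply/seteqP; split=> [x Nx|_ [f Tf ->]]; last first.
  rewrite /uplus polar_hull => y [j _ Ny]; rewrite pairingC pairing_suml.
  apply: le_trans (ler_sum _ (fun i _ => Ny i (f i) (Tf i))).
  by rewrite sumrN (bigD1 j) //= eqxx big1 ?addr0// => i /negPf ->.
have [[s se] _] := lattice_polytope_minkowski_sum lattice_polytope_tilde.
rewrite se; apply: contrapT => nx.
have T0 : hull [set` s] 0.
  rewrite -se; exists (fun=> 0); last by rewrite big1.
  by move=> i; exact: tilde0.
have [y [d xd ds]] := hull_seq_separation (ex_intro _ _ T0) nx.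
(* The minimum of [y] on the Minkowski sum is the sum of its minima on the summands, attained at the
   [v i]. *)
have /choice[v vP] : forall i, exists v,
    T i v /\ forall z, T i z -> pairing v y <= pairing z y.
  move=> i; have [[si sie] _] := lattice_polytope_tilde i.
  have := tilde0 i; rewrite sie => T0'.
  have [v vs vmin] := hull_seq_min y (ex_intro _ _ T0').
  by exists v; split => //; exact: sub_hull.
have d_le : d <= \sum_i pairing (v i) y.
  rewrite -pairing_suml; apply: ds; rewrite -se.
  by exists v => // i; case: (vP i).
(* The [k.+1] increases by [eps] use up half of the gap between [pairing x y] and [d]. They make all
   weights positive and still leave [pairing x y] below minus their sum. *)
pose eps := (d - pairing x y) / (2 * k.+1%:R).
have k0 : 0 < (k.+1%:R : R) by rewrite ltr0n.
have eps0 : 0 < eps by rewrite divr_gt0 ?mulr_gt0// subr_gt0.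
have epsE : \sum_(i < k.+1) eps = (d - pairing x y) / 2.
  by rewrite sumr_const card_ord -[LHS]mulr_natr /eps invfM mulrA mulfVK// gt_eqF.
pose c i := eps - pairing (v i) y.
have c_gt0 i : 0 < c i.
  rewrite subr_gt0; apply: le_lt_trans eps0.
  by have [_ /(_ 0 (tilde0 i))] := vP i; rewrite pairing0l.
have cs : pairing x y < - \sum_i c i by rewrite sumrB epsE; lra.
have s0 : 0 < \sum_i c i.
  by rewrite (bigD1 ord0) //= ltr_wpDr// sumr_ge0// => i _; exact: ltW.
have yc i m : Ds i m -> - c i <= pairing (row_mx m 0 + e i) y.
  move=> Dm; rewrite opprB; have [_ /(_ (row_mx m 0 + e i)) h] := vP i.
  apply: le_trans (h _); first by rewrite gerBl ltW.
  by apply: sub_hull; left; exists m.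
have := nef_dual0_weighted s0 yc; set z := _ *: _ => Nz.
suff : - \sum_i c i <= pairing x y by rewrite leNgt cs.
(* Each [z - E j] lies in [nef_dual T j], so it pairs with [x] to at least -1; weighting by the
   [c j] gives the contradiction. *)
rewrite (@weighted_decomposition c y) ?gt_eqF// pairing_sumr -sumrN.
apply: ler_sum => j _; rewrite pairingZr -mulrN1 ler_pM2l// pairingC.
apply: Nx; apply: sub_hull; exists j => //.
by apply/nef_dual_tilde_shift; rewrite subrK.
Qed.

(** * Identification of the explicit hull with the dual polytope, for reflexive [D] *)

Section Reflexive.
Context (D_reflexive : reflexive_polytope D).

Let D0 : D 0.
Proof. by have [_ /nbhs_singleton] := D_reflexive. Qed.

Let D_polar0 : polar D 0.
Proof. by move=> x _; rewrite pairing0r oppr_le0. Qed.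

(** Minimisers exist because each summand is nonempty: [0], interior to [D], decomposes as a sum of
    points of the summands. *)
Lemma summand_min u : exists m : 'I_k.+1 -> 'rV[R]_n,
  forall i, Ds i (m i) /\ forall x, Ds i x -> pairing (m i) u <= pairing x u.
Proof.
suff /choice : forall i, exists v,
    Ds i v /\ forall x, Ds i x -> pairing v u <= pairing x u.
  by case=> m mP; exists m.
move=> i; have [[s se] _] := Ds_lattice i.
have [f Df _] := D0; have := Df i; rewrite se => fs.
have [v vs vmin] := hull_seq_min u (ex_intro _ _ fs).
by exists v; split=> //; exact: sub_hull.
Qed.

Lemma min_pairing_int i u : lattice_point u -> min_pairing (Ds i) u \is a Num.int.
Proof.
move=> ul; have /lattice_polytopeP[s sl se] := Ds_lattice i.
have [f Df _] := D0; have := Df i; rewrite se => fs.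
have [v vs vmin] := hull_seq_min u (ex_intro _ _ fs).
rewrite (@min_pairingE _ _ _ _ v) //; last exact: sub_hull.
exact: lattice_pairing (sl v vs) ul.
Qed.

(** The sum may start at [ord0], where [E] vanishes; this keeps all indices on the same footing. *)
Definition nabla_gen u : W := row_mx u 0 - \sum_j min_pairing (Ds j) u *: E j.

Lemma nabla_hat0E :
  nabla_hat0 D Ds = hull ([set nabla_gen u | u in polar D] `|` range (@basis_vec R n k)).
Proof.
rewrite /nabla_hat0; congr (hull (_ `|` _)); congr image; apply/funext => u.
rewrite /nabla_gen big_ord_recl e_dual0 scaler0 add0r; congr (_ - _).
by apply: eq_bigr => l _; rewrite e_dualS.
Qed.

Lemma nabla_gen0 : nabla_gen 0 = 0.
Proof.
rewrite /nabla_gen row_mx0 big1 ?subr0// => j _.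
have [m mP] := summand_min 0; have [Dm mmin] := mP j.
by rewrite (min_pairingE Dm mmin) pairing0r scale0r.
Qed.

Lemma e_dual_nabla_hat0 j : nabla_hat0 D Ds (E j).
Proof.
rewrite nabla_hat0E; apply: sub_hull; case: (unliftP ord0 j) => [l ->|->].
  by right; exists l => //; rewrite e_dualS.
by left; exists 0; [exact: D_polar0|rewrite e_dual0 nabla_gen0].
Qed.

(** On [m + e_i] the generator of [u] takes the value [<m, u> - min_i], increased by the sum of all
    minima when [i = ord0]. The difference is nonnegative, and the sum of the minima is a value of
    [u] on [D], hence at least -1. *)
Lemma nabla_hat0_sub : nabla_hat0 D Ds `<=` nef_dual T ord0.
Proof.
rewrite nabla_hat0E; apply: hull_incl => [y z t /nef_dual_tildeP Ny /nef_dual_tildeP Nz t01|y].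
  apply/nef_dual_tildeP => i m Dm.
  have := Ny i m Dm; have := Nz i m Dm; rewrite pairingDr !pairingZr; nra.
case=> [[u Du <-]|[l _ <-]]; apply/nef_dual_tildeP => i m Dm; last first.
  by rewrite -e_dualS pairing_gen_e_dual lerDr ler0n.
have [f fP] := summand_min u.
have fE j : min_pairing (Ds j) u = pairing (f j) u.
  by have [Df fmin] := fP j; exact: min_pairingE.
rewrite pairingDr pairingNr pairing_gen_row0 pairing_gen_sum_e_dual fE.
have -> : \sum_j min_pairing (Ds j) u = pairing (\sum_j f j) u.
  by rewrite pairing_suml; apply: eq_bigr => j _.
have : -1 <= pairing (\sum_j f j) u by apply: Du; exists f => // j; case: (fP j).
have [_ /(_ m Dm)] := fP i.
by case: (i == ord0) => /=; lra.
Qed.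

(* A face of the polar polytope on which [m] takes the value -1 lies in a cone
   of linearity of all the support functions, where [nabla_gen] is linear. *)
Lemma nef_dual0_sub (s : seq 'rV[R]_n) : polar D = hull [set` s] ->
  nef_dual T ord0 `<=` hull ([set nabla_gen v | v in [set` s]] `|` range E).
Proof.
move=> se y /nef_dual_tildeP Ny; set F := hull _.
have FE j : F (E j) by apply: sub_hull; right; exists j.
pose u := lsubmx y.
have [f fP] := summand_min u.
pose m := \sum_j f j.
have Dm : D m by exists f => // j; case: (fP j).
(* [nabla_gen] with the minimisers frozen at those of [u], hence linear in [v]. *)
pose L v : W := row_mx v 0 - \sum_j pairing (f j) v *: E j.
have LZ t v : L (t *: v) = t *: L v.
  rewrite /L scalerBr scale_row_mx scaler0 scaler_sumr; congr (_ - _).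
  by apply: eq_bigr => j _; rewrite pairingZr scalerA.
have LD v w : L (v + w) = L v + L w.
  rewrite /L addrACA add_row_mx addr0 -opprD -big_split /=; congr (_ - _).
  by apply: eq_bigr => j _; rewrite pairingDr scalerDl.
(* A point of the face [<m, v> = -1] is a mixture of generators on that face, and there [L] agrees
   with [nabla_gen]. *)
have Lface v : polar D v -> pairing m v = -1 -> F (L v).
  rewrite se => sv mv.
  suff [_] : -1 <= pairing m v /\ (pairing m v = -1 -> F (L v)) by apply.
  apply: (@hull_incl _ _ _
    [set v | -1 <= pairing m v /\ (pairing m v = -1 -> F (L v))] _ _ v sv)
    => [a b t [ma Fa] [mb Fb] t01|a sa] /=.
    rewrite pairingDr !pairingZr; split; first exact: conv_lb.
    by move=> /(conv_lb_eq ma mb t01)[/Fa {}Fa /Fb {}Fb]; rewrite LD !LZ; exact: hull_convex.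
  have Da : polar D a by rewrite se; exact: sub_hull.
  split=> [|ma]; first exact: Da.
  apply: sub_hull; left; exists a => //; rewrite /nabla_gen /L; congr (_ - _).
  apply: eq_bigr => j _; congr (_ *: _); apply: min_pairingE; first by case: (fP j).
  (* Exchanging the summand [f j] of [m] for [x] stays in [D], so it cannot lower the value -1 at
     [a]; thus [f j] also minimises [a] on [Ds j]. *)
  move=> x Dx; have : -1 <= pairing (\sum_i (if i == j then x else f i)) a.
    apply: Da; exists (fun i => if i == j then x else f i) => // i.
    by case: eqP => [->|] //; case: (fP i).
  have -> : \sum_i (if i == j then x else f i) = x + \sum_(i | i != j) f i.
    by rewrite (bigD1 j) //= eqxx; congr (_ + _); apply: eq_bigr => i /negPf ->.
  rewrite -ma /m (bigD1 j) //= !pairingDl.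
  by rewrite lerD2r.
have Lu v : (forall j, pairing (f j) v = 0) -> L v = row_mx v 0.
  by move=> fv; rewrite /L big1 ?subr0// => j _; rewrite fv scale0r.
(* The values of [y] on the generators [f j + e_j]; they are also the coefficients that express
   [y - L u] through the [E j]. *)
pose h j := pairing (row_mx (f j) 0 + e j) y.
have hE j : h j = pairing (f j) u + pairing (e j) y.
  rewrite /h pairingDl; congr (_ + _).
  by rewrite -[y in LHS]hsubmxK pairing_row_mx pairing0l addr0.
have yE : y = L u + \sum_j h j *: E j.
  rewrite {1}(row0_sum_e_dual y) -/u /L -addrA; congr (_ + _).
  rewrite addrC -sumrB; apply: eq_bigr => j _.
  by rewrite -scalerBl hE addrC addKr.
have hsum : \sum_j h j = pairing m u.
  under eq_bigr do rewrite hE.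
  by rewrite big_split /= -!pairing_suml sum_e_vec pairing0l addr0.
have mmin x : D x -> pairing m u <= pairing x u.
  move=> [g Dg ->]; rewrite !pairing_suml; apply: ler_sum => j _.
  by have [_] := fP j; exact.
(* The bound at [ord0] is -1, so adding 1 there makes every coefficient nonnegative; the combination
   is unaffected because [E ord0 = 0]. *)
pose c j := h j + (j == ord0)%:R.
have c_ge0 j : 0 <= c j.
  by have := Ny j (f j) (fP j).1; rewrite -/(h j) /c; lra.
have sum_c : \sum_j c j = 1 + pairing m u.
  rewrite big_split /= hsum addrC; congr (_ + _).
  by rewrite (bigD1 ord0) //= big1 ?addr0// => j /negPf ->.
have t1 : 0 <= 1 + pairing m u by rewrite -sum_c sumr_ge0.
have t0 : pairing m u <= 0 by rewrite -(pairing0l u); exact: mmin.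
have sum_hc : \sum_j h j *: E j = \sum_j c j *: E j.
  apply: eq_bigr => j _; rewrite /c scalerDl.
  have [->|_] := eqVneq j ord0; first by rewrite e_dual0 !scaler0 addr0.
  by rewrite scale0r addr0.
have [z Fz cz] : exists2 z, F z & \sum_j c j *: E j = (\sum_j c j) *: z.
  apply: hull_sum => [|j _]; last by split; [exact: c_ge0|exact: FE].
  by exists (E ord0); right; exists ord0.
rewrite yE sum_hc cz sum_c.
(* If the minimum of [u] on [D] is 0, then [u = 0], since 0 is interior to [D], and [y = z]. *)
have [mu0|mu0] := eqVneq (pairing m u) 0.
  rewrite mu0; have -> : u = 0.
    have [_ Dint _] := D_reflexive; apply: (interior_pairing_ge0 Dint) => x Dx.
    by rewrite -mu0; exact: mmin.
  rewrite addr0 scale1r Lu => [|j]; last by rewrite pairing0r.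
  by rewrite row_mx0 add0r.
(* Dividing [u] by [t] brings it onto the face [<m, v> = -1] of the polar, and [y] becomes the
   mixture [t L(u / t) + (1 - t) z] of points of [F]. *)
pose t := - pairing m u.
have t_gt0 : 0 < t by rewrite oppr_gt0 lt_neqAle mu0.
have -> : u = t *: (t^-1 *: u) by rewrite scalerA mulfV ?scale1r// gt_eqF.
rewrite LZ; have -> : 1 + pairing m (t *: (t^-1 *: u)) = 1 - t.
  by rewrite scalerA mulfV ?gt_eqF// scale1r opprK.
have Ft : F (L (t^-1 *: u)).
  apply: Lface => [x Dx|].
    rewrite pairingZr mulrC ler_pdivlMr// mulN1r opprK; exact: mmin.
  by rewrite pairingZr -[pairing m u]opprK -/t mulrN mulVf ?gt_eqF.
move: Ft; have [->|tN1] := eqVneq t 1 => Ft; first by rewrite subrr scale0r addr0 scale1r.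
apply: hull_convex => //; rewrite t_gt0 lt_neqAle tN1 /=.
by rewrite /t lerNl -subr_ge0 opprK addrC.
Qed.

(** The hull over a finite lattice generating list of the polar lies in [nabla_hat0], which lies in
    the dual polytope, which lies in that finite hull. All three coincide, and the finite list
    consists of lattice points. *)
Lemma nabla_hat0_nef_dual :
  nabla_hat0 D Ds = nef_dual T ord0 /\ lattice_polytope (nabla_hat0 D Ds).
Proof.
have [_ _ /lattice_polytopeP[s sl se]] := D_reflexive.
have Fsub : hull ([set nabla_gen v | v in [set` s]] `|` range E) `<=` nabla_hat0 D Ds.
  rewrite nabla_hat0E; apply: hull_min => x [[v sv <-]|[j _ <-]].
    by apply: sub_hull; left; exists v => //; rewrite se; exact: sub_hull.
  by rewrite -nabla_hat0E; exact: e_dual_nabla_hat0.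
have subF := nef_dual0_sub se.
have NE : nabla_hat0 D Ds = nef_dual T ord0.
  by apply/seteqP; split; [exact: nabla_hat0_sub|move=> y /subF/Fsub].
split=> //; apply/lattice_polytopeP.
exists ([seq nabla_gen v | v <- s] ++ [seq E j | j : 'I_k.+1]).
  move=> x; rewrite mem_cat => /orP[/mapP[v /sl vl ->]|/mapP[j _ ->]]; last first.
    exact: lattice_point_e_dual.
  apply: lattice_pointD; first by apply: lattice_point_row_mx => //; exact: lattice_point0.
  apply: lattice_pointN; apply: lattice_point_sum => j _.
  by apply: lattice_pointZ; [exact: min_pairing_int|exact: lattice_point_e_dual].
transitivity (hull ([set nabla_gen v | v in [set` s]] `|` range E)).
  by apply/seteqP; split => // y; rewrite NE => /subF.
congr hull; apply/seteqP; split=> x /=; rewrite mem_cat.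
  case=> [[v sv <-]|[j _ <-]]; apply/orP; [left|right]; apply: map_f => //.
  by rewrite mem_enum.
by case/orP=> [/mapP[v sv ->]|/mapP[j _ ->]]; [left; exists v|right; exists j].
Qed.

Lemma nabla_hat_nef_dual j : nabla_hat D Ds j = nef_dual T j.
Proof.
rewrite nabla_hatE nabla_hat0_nef_dual.1.
apply/seteqP; split=> [_ [y Ny <-]|y Ny].
  by apply/nef_dual_tilde_shift; rewrite subrK.
exists (y + E j); last by rewrite addrK.
exact: (nef_dual_tilde_shift j y).1 Ny.
Qed.

Lemma lattice_polytope_nabla_hat j : lattice_polytope (nabla_hat D Ds j).
Proof.
rewrite nabla_hatE; apply: lattice_polytope_shift; last exact: nabla_hat0_nef_dual.2.
by apply: lattice_pointN; exact: lattice_point_e_dual.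
Qed.

Lemma nabla_hat_contains0 j : nabla_hat D Ds j 0.
Proof. by rewrite nabla_hatE; exists (E j); [exact: e_dual_nabla_hat0|rewrite subrr]. Qed.

End Reflexive.
End Duality.

(** * Reflexivity of the two Minkowski sums and the conclusion *)

(** The bipolar theorem returns the lattice polytope [uplus P], and the polar of a polytope has 0 in
    its interior. Both Minkowski sums are polars of this kind, so their reflexivity reduces to being
    lattice polytopes. *)
Lemma reflexive_polar_uplus (R : realType) (n m : nat) (P : 'I_m.+1 -> set 'rV[R]_n) :
  (forall i, lattice_polytope (P i)) -> P ord0 0 ->
  lattice_polytope (polar (uplus P)) -> reflexive_polytope (polar (uplus P)).
Proof.
move=> Pl P0 pl; have ul := lattice_polytope_uplus Pl.
split=> //; last first.
  by rewrite bipolar_lattice_polytope//; apply: sub_hull; exists ord0.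
by have [[s ->] _] := ul; exact: polar_hull_seq_interior.
Qed.

Theorem proposition1p13 (R : realType) (n k : nat) (Delta : set 'rV[R]_n)
    (Deltas : 'I_k.+1 -> set 'rV[R]_n)
    (Delta_reflexive : reflexive_polytope Delta)
    (Deltas_lattice : forall i, lattice_polytope (Deltas i))
    (Delta_sum : Delta = minkowski_sum Deltas) :
  let nabla := nabla_hat Delta Deltas in
  let tDelta := Delta_tilde Deltas in
  [/\ reflexive_polytope (minkowski_sum nabla),
      [/\ nef_partition (minkowski_sum tDelta) tDelta,
          nef_partition (minkowski_sum nabla) nabla
        & forall j, nabla j = nef_dual tDelta j],
      polar (uplus nabla) = minkowski_sum tDelta
    & polar (uplus tDelta) = minkowski_sum nabla].
Proof.
subst Delta => nabla tDelta.
have nablaE : nabla = nef_dual tDelta.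
  by apply/funext => j; exact: nabla_hat_nef_dual.
have nabla_lattice j : lattice_polytope (nabla j) by exact: lattice_polytope_nabla_hat.
have nabla0 j : nabla j 0 by exact: nabla_hat_contains0.
have tDelta_lattice j : lattice_polytope (tDelta j) by exact: lattice_polytope_tilde.
have polar_nabla : polar (uplus nabla) = minkowski_sum tDelta.
  by rewrite nablaE; exact: polar_uplus_nef_dual.
have polar_tDelta : polar (uplus tDelta) = minkowski_sum nabla.
  by rewrite nablaE; exact: polar_uplus_tilde.
have nabla_reflexive : reflexive_polytope (minkowski_sum nabla).
  rewrite -polar_tDelta; apply: reflexive_polar_uplus => //; first exact: tilde0.
  by rewrite polar_tDelta; exact: lattice_polytope_minkowski_sum.
have tDelta_reflexive : reflexive_polytope (minkowski_sum tDelta).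
  rewrite -polar_nabla; apply: reflexive_polar_uplus => //.
  by rewrite polar_nabla; exact: lattice_polytope_minkowski_sum.
split=> //; split=> [||j]; last by rewrite nablaE.
- by split=> // i; split=> //; exact: tilde0.
- by split.
Qed.
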